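(* Let $\mu_1,\mu_2\in[-\pi,\pi)$, $\kappa_1,\kappa_2\ge 0$, $\kappa_3\in\mathbb{R}$, and let $(\Theta,\Phi)$ have either the bivariate von Mises sine distribution or the bivariate von Mises cosine distribution with parameters $\kappa_1,\kappa_2,\kappa_3,\mu_1,\mu_2$. Then the Jammalamadaka-Sarma circular correlation coefficient satisfies $$\operatorname{sgn}(\rho_{\mathrm{JS}}(\Theta,\Phi))=\operatorname{sgn}(\kappa_3),$$ where $\operatorname{sgn}(x)=1$ if $x>0$, $\operatorname{sgn}(x)=-1$ if $x<0$, and $\operatorname{sgn}(0)=0$.
   Context: Both distributions are supported on $[-\pi,\pi)^2$, with parameters $\kappa_1,\kappa_2\ge0$, $\kappa_3\in\mathbb{R}$, $\mu_1,\mu_2\in[-\pi,\pi)$. Von Mises sine distribution: density proportional to $$\exp[\kappa_1\cos(\theta-\mu_1)+\kappa_2\cos(\phi-\mu_2)+\kappa_3\sin(\theta-\mu_1)\sin(\phi-\mu_2)].$$ Von Mises cosine distribution: density proportional to $$\exp[\kappa_1\cos(\theta-\mu_1)+\kappa_2\cos(\phi-\mu_2)+\kappa_3\cos(\theta-\mu_1-\phi+\mu_2)].$$ Jammalamadaka-Sarma coefficient: $$\rho_{\mathrm{JS}}(\Theta,\Phi)=\frac{E[\sin(\Theta-\mu_1)\sin(\Phi-\mu_2)]}{\sqrt{E[\sin^2(\Theta-\mu_1)]\,E[\sin^2(\Phi-\mu_2)]}},$$ where the location parameters $\mu_1,\mu_2$ of the model serve as the circular means of $\Theta,\Phi$. 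*)

(* Defs.v *)
From HB Require Import structures.
From mathcomp Require Import all_boot all_order all_algebra.
From mathcomp Require Import all_classical all_reals all_analysis.

Set Implicit Arguments.
Unset Strict Implicit.
Unset Printing Implicit Defensive.

Import Order.TTheory GRing.Theory Num.Theory.
Import numFieldNormedType.Exports.

Local Open Scope classical_set_scope.
Local Open Scope ring_scope.

Local Notation lebesgue2 := (lebesgue_measure \x lebesgue_measure)%E.

Section bivariate_von_mises.
Context {R : realType}.
Variables k1 k2 k3 mu1 mu2 : R.

Definition torus : set (R * R) := `[- pi, pi[ `*` `[- pi, pi[.

Definition von_mises_sine_fun (x : R * R) : R :=
  expR (k1 * cos (x.1 - mu1) + k2 * cos (x.2 - mu2)
        + k3 * (sin (x.1 - mu1) * sin (x.2 - mu2))).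

Definition von_mises_cosine_fun (x : R * R) : R :=
  expR (k1 * cos (x.1 - mu1) + k2 * cos (x.2 - mu2)
        + k3 * cos (x.1 - mu1 - x.2 + mu2)).

(* The probability density on R^2 that is proportional to g on the torus and
   vanishes outside; the division is meaningful when the integral of g is
   finite and nonzero, as it is for the two von Mises weights above. *)
Definition torus_pdf (g : R * R -> R) (x : R * R) : R :=
  \1_torus x * (g x / fine (\int[lebesgue2]_(y in torus) (g y)%:E)%E).

Definition von_mises_sine_pdf := torus_pdf von_mises_sine_fun.
Definition von_mises_cosine_pdf := torus_pdf von_mises_cosine_fun.

End bivariate_von_mises.

Definition has_joint_pdf {d} {T : measurableType d} {R : realType}
    (P : probability T R) (X Y : {RV P >-> R}) (f : R * R -> R) : Prop :=
  forall A : set (R * R), measurable A ->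
    pushforward P (fun w => (X w, Y w)) A
    = (\int[lebesgue2]_(x in A) (f x)%:E)%E.

(* Jammalamadaka-Sarma coefficient of X and Y about the directions mu1, mu2.
   All the expectations are of bounded random variables, so fine loses
   nothing. *)
Definition rho_JS {d} {T : measurableType d} {R : realType}
    (P : probability T R) (mu1 mu2 : R) (X Y : {RV P >-> R}) : R :=
  fine 'E_P[fun w => sin (X w - mu1) * sin (Y w - mu2)]
  / Num.sqrt (fine 'E_P[fun w => sin (X w - mu1) ^+ 2]
              * fine 'E_P[fun w => sin (Y w - mu2) ^+ 2]).

(* Main.v *)
Require Import Defs.
From mathcomp Require Import all_boot all_order all_algebra.
From mathcomp Require Import all_classical all_reals all_analysis.
From mathcomp Require Import measurable_realfun ring lra.
Import Order.TTheory GRing.Theory Num.Theory.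
Import numFieldNormedType.Exports.
Set Implicit Arguments.
Unset Strict Implicit.
Unset Printing Implicit Defensive.
Local Open Scope ring_scope.

(** Write [a = x - mu1] and [b = y - mu2]. Expanding [cos (a - b)], both
    densities are proportional to
      [w_k (x, y) = exp (A(y) cos a + B(y) + k sin a sin b)],  [k = kappa3].
    For [k = 0] the integral of [sin a sin b w_0] vanishes: for fixed [y] the
    integrand in [x] is the derivative of a [2 pi]-periodic function. Hence
    [k] times the integral of [sin a sin b w_k] is the integral of
    [u (exp u - 1) w_0] with [u = k sin a sin b], and [u (exp u - 1) > 0] for
    [u <> 0]. So the numerator of the coefficient has the sign of [k], and the
    denominator is positive. *)

(** * Integration against a measure given by a density *)

Section density.
Local Open Scope ereal_scope.
Context {d : measure_display} {T : measurableType d} {R : realType}.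
Variables (mu nu : {measure set T -> \bar R}) (p : T -> R).
Hypothesis mp : measurable_fun setT p.
Hypothesis p0 : forall x, (0 <= p x)%R.
Hypothesis nuE : forall A, measurable A -> nu A = \int[mu]_(x in A) (p x)%:E.

Import HBNNSimple.

Let density_indic (A : set T) : measurable A ->
  \int[nu]_x (\1_A x)%:E = \int[mu]_x ((\1_A x)%:E * (p x)%:E).
Proof.
move=> mA; rewrite integral_indic// setIT nuE// integral_mkcond.
apply: eq_integral => x _; rewrite patchE indicE.
by case: ifPn => _; rewrite ?mul1e ?mul0e.
Qed.

Let density_nnsfun (f : {nnsfun T >-> R}) :
  \int[nu]_x (f x)%:E = \int[mu]_x ((f x)%:E * (p x)%:E).
Proof.
under [LHS]eq_integral do rewrite fimfunE -fsumEFin//.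
rewrite [LHS]ge0_integral_fsum//; last 2 first.
- by move=> r; exact/measurable_EFinP/measurableT_comp.
- by move=> n x _; rewrite EFinM nnfun_muleindic_ge0.
under [RHS]eq_integral.
  move=> x xD; rewrite fimfunE -fsumEFin// muleC ge0_mule_fsumr; last first.
    by move=> r; rewrite EFinM nnfun_muleindic_ge0.
  over.
rewrite [RHS]ge0_integral_fsum//; last 2 first.
- move=> r; apply/emeasurable_funM; first exact/measurable_EFinP.
  by apply/measurable_EFinP; exact/measurableT_comp.
- move=> n x _; rewrite mule_ge0 ?lee_fin//.
  by rewrite -lee_fin EFinM nnfun_muleindic_ge0.
apply: eq_fsbigr => r _.
(* A nonnegative simple function takes no negative value, so the terms with [r < 0] have empty
   preimage and vanish on both sides. The remaining case supplies the sign needed to pull [r] out of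
   the integral. *)
have [r0|r0] := ltP r 0%R.
  rewrite preimage_nnfun0//.
  by rewrite !integral0_eq// => x _; rewrite indic0 mulr0 ?mule0.
under [RHS]eq_integral do rewrite EFinM muleCA.
rewrite ge0_integralZl//; last 2 first.
- by apply: emeasurable_funM; apply/measurable_EFinP.
- by move=> x _; rewrite mule_ge0 ?lee_fin.
rewrite integralZl_indic_nnsfun// density_indic//.
by congr (_ * _); apply: eq_integral => x _; rewrite muleC.
Qed.

(** The hypothesis [nuE] is the case of indicators. Linearity extends it to nonnegative simple
    functions, and monotone convergence along [nnsfun_approx], used once for [nu] and once for [mu],
    reaches [f]. *)
Lemma ge0_integral_density (f : T -> \bar R) :
  measurable_fun setT f -> (forall x, 0 <= f x) ->
  \int[nu]_x f x = \int[mu]_x (f x * (p x)%:E).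
Proof.
move=> mf f0; pose f_ := nnsfun_approx measurableT mf.
transitivity (limn (fun n => \int[nu]_x (f_ n x)%:E)).
  rewrite -monotone_convergence//=.
  - apply: eq_integral => x _; apply/esym/cvg_lim => //=.
    exact: cvg_nnsfun_approx.
  - by move=> n; exact/measurable_EFinP.
  - by move=> n x _; rewrite lee_fin.
  - by move=> x _ m n mn; rewrite lee_fin; exact/lefP/nd_nnsfun_approx.
under eq_fun do rewrite density_nnsfun.
rewrite -monotone_convergence//=; last 3 first.
- by move=> n; apply: emeasurable_funM; exact/measurable_EFinP.
- by move=> n x _; rewrite mule_ge0 ?lee_fin.
- move=> x _ m n mn; rewrite lee_wpmul2r ?lee_fin//.
  exact/lefP/nd_nnsfun_approx.
apply: eq_integral => x _; apply/cvg_lim => //=.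
by apply: cvgeZr => //; exact: cvg_nnsfun_approx.
Qed.

(** Multiplication by the nonnegative [p] commutes with taking positive and negative parts, so the
    nonnegative case applies to each part. *)
Lemma integral_density (f : T -> R) : measurable_fun setT f ->
  \int[nu]_x (f x)%:E = \int[mu]_x (f x * p x)%:E.
Proof.
move=> /measurable_EFinP mf; rewrite [LHS]integralE [RHS]integralE.
rewrite ge0_integral_density//; last exact: measurable_funepos.
rewrite ge0_integral_density//; last exact: measurable_funeneg.
congr (_ - _); apply: eq_integral => x _.
  by rewrite !funeposE maxe_pMl ?lee_fin// mul0e.
by rewrite !funenegE maxe_pMl ?lee_fin// mul0e mulNe EFinM.
Qed.

End density.

(** * Positive and vanishing integrals over the torus and the circle *)

Section torus_integrals.
Local Open Scope classical_set_scope.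
Context {R : realType}.
(* [lebesgue_measure] lives on [measurableTypeR R], whose sigma-algebra is
   convertible to that of [R] but carries another display. *)
Local Notation mR := (measurableTypeR R).
Implicit Types (mu : R) (f : mR * mR -> R).
Local Notation circle := (`[- (pi : R), pi[%classic).
Local Notation lebesgue2 :=
  ((@lebesgue_measure R) \x (@lebesgue_measure R))%E.

(** Of the two half-periods adjacent to [mu], one stays inside the fundamental interval: the right
    one if [mu <= 0], the left one otherwise. *)
Lemma sin_neq0_itv mu : - pi <= mu < pi -> exists ab : R * R,
  [/\ ab.1 < ab.2, `]ab.1, ab.2[ `<=` `[- pi, pi[ &
      forall x, `]ab.1, ab.2[ x -> sin (x - mu) != 0].
Proof.
have p0 := pi_gt0 R.
move=> /andP[mu1 mu2]; have [mu0|mu0] := leP mu 0.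
- exists (mu, mu + pi); split => /=; first by lra.
  + by move=> x /=; rewrite !in_itv/=; lra.
  + move=> x /=; rewrite in_itv/= => /andP[x1 x2].
    by rewrite gt_eqF// sin_gt0_pi//; lra.
- exists (mu - pi, mu); split => /=; first by lra.
  + by move=> x /=; rewrite !in_itv/=; lra.
  + move=> x /=; rewrite in_itv/= => /andP[x1 x2].
    rewrite -(opprB mu x) sinN oppr_eq0.
    by rewrite gt_eqF// sin_gt0_pi//; lra.
Qed.

Lemma measurable_torus : measurable (torus : set (mR * mR)).
Proof. exact: measurableX. Qed.

Lemma lebesgue2_torus_lty : (lebesgue2 (@torus R) < +oo)%E.
Proof.
rewrite product_measure1E//= lebesgue_measure_itv/=.
by case: ifP => _; rewrite ?mule0 ?ltry.
Qed.

(** If the integral were zero, [f] would vanish almost everywhere on the torus. But [f] has no zero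
    on the product of the two intervals given by [sin_neq0_itv], a box of positive area. *)
Lemma integral_torus_gt0 mu1 mu2 f :
  - pi <= mu1 < pi -> - pi <= mu2 < pi ->
  measurable_fun setT f -> (forall z, 0 <= f z) ->
  (forall z, sin (z.1 - mu1) != 0 -> sin (z.2 - mu2) != 0 -> f z != 0) ->
  (0 < \int[lebesgue2]_(z in torus) (f z)%:E)%E.
Proof.
move=> hmu1 hmu2 mf f0 fN0.
have [[a b] /= [ab abpi sab]] := sin_neq0_itv hmu1.
have [[c d] /= [cd cdpi scd]] := sin_neq0_itv hmu2.
rewrite lt0e; apply/andP; split; last first.
  by apply: integral_ge0 => z _; rewrite lee_fin.
apply/eqP => I0.
have mfE : measurable_fun (torus : set (mR * mR)) (fun z => (f z)%:E).
  by apply/measurable_EFinP; exact: measurable_funTS.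
have : (\int[lebesgue2]_(z in torus) `|(f z)%:E| = 0)%E.
  by rewrite -[RHS]I0; apply: eq_integral => z _; rewrite gee0_abs// lee_fin.
move/(ae_eq_integral_abs lebesgue2 measurable_torus mfE) => ae0.
have : lebesgue2.-negligible (`]a, b[ `*` `]c, d[).
  apply: negligibleS ae0 => -[x y] [/= xab ycd] /= h.
  have txy : torus (x, y) by split => /=; [exact: abpi|exact: cdpi].
  by have /eqP := fN0 (x, y) (sab _ xab) (scd _ ycd); apply; case: (h txy).
have mbox : measurable (`]a, b[ `*` `]c, d[ : set (mR * mR)).
  by apply: measurableX; exact: measurable_itv.
move=> nbox; have box0 := measure_negligible mbox nbox.
have : (0 < lebesgue2 (`]a, b[ `*` `]c, d[))%E.
  rewrite product_measure1E//= !lebesgue_measure_itv/= !lte_fin ab cd.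
  by rewrite -!EFinB -EFinM lte_fin mulr_gt0// subr_gt0.
by rewrite [ltRHS]box0 ltxx.
Qed.

Lemma integral_itv_pi_derive (f F : R -> R) :
  continuous f -> (forall x : R, is_derive x 1 F (f x)) -> F pi = F (- pi) ->
  (\int[lebesgue_measure]_(x in circle) (f x)%:E = 0)%E.
Proof.
move=> cf dF Fpi; rewrite integral_itv_bndo_bndc; last first.
  apply/measurable_EFinP/measurable_funTS; exact: continuous_measurable_fun.
rewrite (@continuous_FTC2 _ f F)//.
- by rewrite Fpi subee.
- by have := pi_gt0 R; lra.
- exact: continuous_subspaceT.
- have cF : continuous F.
    move=> x; apply: differentiable_continuous.
    by apply/derivable1_diffP; case: (dF x).
  split => //.
  + by apply: cvg_at_right_filter; exact: cF.
  + by apply: cvg_at_left_filter; exact: cF.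
- by move=> x _; rewrite derive1E derive_val.
Qed.

(** Up to a constant factor, the integrand is the derivative of [expR (A * cos (x - mu) + B)] when
    [A] is nonzero, and of [cos (x - mu)] when [A = 0]. Both are periodic, so they agree at [- pi]
    and [pi]. *)
Lemma integral_sin_expR_cos (A B C mu : R) :
  (\int[lebesgue_measure]_(x in circle)
    (sin (x - mu) * expR (A * cos (x - mu) + B) * C)%:E = 0)%E.
Proof.
have cospiB : cos (pi - mu) = cos (- pi - mu).
  have -> : pi - mu = - pi - mu + pi *+ 2 by rewrite mulr2n; ring.
  by rewrite cosD2pi.
have dcos (x : R) :
    is_derive x 1 (fun y : R => cos (y - mu)) (- sin (x - mu)).
  rewrite -[- sin _]mulr1.
  apply: (@is_derive1_comp _ cos (fun y : R => y - mu)).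
  by apply: is_derive_eq; rewrite subr0.
have csin : continuous (fun x : R => sin (x - mu)).
  move=> x; apply: (@continuous_comp _ _ _ (fun y : R => y - mu) sin).
    by apply: cvgB; [exact: cvg_id|exact: cvg_cst].
  exact: continuous_sin.
have ccos : continuous (fun x : R => cos (x - mu)).
  move=> x; apply: (@continuous_comp _ _ _ (fun y : R => y - mu) cos).
    by apply: cvgB; [exact: cvg_id|exact: cvg_cst].
  exact: continuous_cos.
(* The antiderivative of the general case carries the factor [A^-1], which is [0] for [A = 0]; hence
   the separate case. *)
have [->|A0] := eqVneq A 0.
- under eq_integral do rewrite mul0r add0r.
  apply: (@integral_itv_pi_derive _ (fun x => - (cos (x - mu) * expR B * C))).
  + by move=> x; do 2 (apply: cvgM; last exact: cvg_cst); exact: csin.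
  + move=> x; apply: is_derive_eq.
    by rewrite /GRing.scale/=; ring.
  + by rewrite cospiB.
- apply: (@integral_itv_pi_derive _
    (fun x => - (A^-1 * expR (A * cos (x - mu) + B) * C))).
  + move=> x; apply: cvgM; last exact: cvg_cst.
    apply: cvgM; first exact: csin.
    apply: (@continuous_comp _ _ _ (fun y : R => A * cos (y - mu) + B) expR).
      apply: cvgD; last exact: cvg_cst.
      by apply: cvgM; [exact: cvg_cst|exact: ccos].
    exact: continuous_expR.
  + move=> x.
    have de : is_derive x 1 (fun y : R => A * cos (y - mu) + B)
        (- (A * sin (x - mu))).
      by apply: is_derive_eq; rewrite /GRing.scale/=; ring.
    have dE : is_derive x 1 (fun y : R => expR (A * cos (y - mu) + B))
        (- (A * sin (x - mu)) * expR (A * cos (x - mu) + B)).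
      rewrite mulrC.
      exact: (@is_derive1_comp _ expR (fun y : R => A * cos (y - mu) + B)).
    apply: is_derive_eq.
    by rewrite /GRing.scale/=; field.
  + by rewrite cospiB.
Qed.

End torus_integrals.

(** * A family of weights containing both von Mises models *)

Section von_mises_weight.
Local Open Scope classical_set_scope.
Context {R : realType}.
Local Notation mR := (measurableTypeR R).
Local Notation circle := (`[- (pi : R), pi[%classic).
Local Notation lebesgue2 :=
  ((@lebesgue_measure R) \x (@lebesgue_measure R))%E.
Local Notation torus := (@torus R).

Lemma integrable_torus (f : mR * mR -> R) (M : R) :
  measurable_fun setT f -> (forall z, `|f z| <= M) ->
  lebesgue2.-integrable torus (EFin \o f).
Proof.
move=> mf fM; apply: measurable_bounded_integrable.
- exact: measurable_torus.
- exact: lebesgue2_torus_lty.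
- exact: measurable_funTS.
- exists M; split; first exact: num_real.
  by move=> y My z _; exact: le_trans (fM z) (ltW My).
Qed.

Variables (A B : R -> R) (CA CB : R) (mu1 mu2 : R).
Hypotheses (mA : measurable_fun setT (A : mR -> mR))
           (mB : measurable_fun setT (B : mR -> mR)).
Hypotheses (AC : forall y, `|A y| <= CA) (BC : forall y, `|B y| <= CB).

(** In the sine model [A] is constant; in the cosine model it absorbs the product of cosines from
    the expanded interaction term. Keeping [A] and [B] functions of the second angle alone makes the
    integral in the first angle explicit at [k = 0]. *)
Definition weight (k : R) (z : mR * mR) : R :=
  expR (A z.2 * cos (z.1 - mu1) + B z.2
        + k * (sin (z.1 - mu1) * sin (z.2 - mu2))).

Let ss (z : mR * mR) : R := sin (z.1 - mu1) * sin (z.2 - mu2).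

Let mphi1 (phi : R -> R) : continuous phi ->
  measurable_fun setT (fun z : mR * mR => phi (z.1 - mu1)).
Proof.
move=> /continuous_measurable_fun mphi.
have mz : measurable_fun setT (fun z : mR * mR => z.1 - mu1).
  by apply: measurable_funD; [exact: measurable_fst|exact: measurable_cst].
exact: (measurableT_comp mphi mz).
Qed.

Let mphi2 (phi : R -> R) : continuous phi ->
  measurable_fun setT (fun z : mR * mR => phi (z.2 - mu2)).
Proof.
move=> /continuous_measurable_fun mphi.
have mz : measurable_fun setT (fun z : mR * mR => z.2 - mu2).
  by apply: measurable_funD; [exact: measurable_snd|exact: measurable_cst].
exact: (measurableT_comp mphi mz).
Qed.

Let msin1 := mphi1 (@continuous_sin R).
Let msin2 := mphi2 (@continuous_sin R).

Let mss : measurable_fun setT ss.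
Proof. exact: measurable_funM. Qed.

Let mweight k : measurable_fun setT (weight k).
Proof.
apply: (@measurableT_comp _ _ _ _ _ _ expR) => //.
apply: measurable_funD; last exact: measurable_funM.
apply: measurable_funD; last first.
  by apply: measurableT_comp => //; exact: measurable_snd.
apply: measurable_funM.
  by apply: measurableT_comp => //; exact: measurable_snd.
exact: mphi1 (@continuous_cos R).
Qed.

Let ss_le1 z : `|ss z| <= 1.
Proof. by rewrite normrM mulr_ile1// sin_max. Qed.

Let weight_gt0 k z : 0 < weight k z. Proof. exact: expR_gt0. Qed.

Let weight_le k z : weight k z <= expR (CA + CB + `|k|).
Proof.
rewrite ler_expR; apply: le_trans (ler_norm _) _.
apply: le_trans (ler_normD _ _) _; apply: lerD; last first.
  by rewrite normrM ler_piMr// ss_le1.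
apply: le_trans (ler_normD _ _) _; apply: lerD => //.
by rewrite normrM; apply: le_trans (AC z.2); rewrite ler_piMr// cos_max.
Qed.

Let integrable_weight k (h : mR * mR -> R) : measurable_fun setT h ->
  (forall z, `|h z| <= 1) ->
  lebesgue2.-integrable torus (EFin \o (fun z => h z * weight k z)).
Proof.
move=> mh h1; apply: (@integrable_torus _ (expR (CA + CB + `|k|))).
  exact: measurable_funM.
move=> z; rewrite normrM (gtr0_norm (weight_gt0 _ _)).
by apply: le_trans (weight_le k z); rewrite ler_piMl// ltW.
Qed.

Lemma integral_sin_sin_weight0 :
  (\int[lebesgue2]_(z in torus) (ss z * weight 0 z)%:E = 0)%E.
Proof.
(* Fubini with the first angle innermost: at fixed [y] the coefficients [A y], [B y] and
   [sin (y - mu2)] are constants, as [integral_sin_expR_cos] requires. *)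
rewrite integral_mkcond -integral21_prod_meas1; last first.
  apply/(integrable_mkcond _ (@measurable_torus R)).
  exact: integrable_weight mss ss_le1.
apply: integral0_eq => y _; rewrite /fubini_G.
have [ypi|ypi] := boolP (y \in circle); last first.
  apply: integral0_eq => x _; rewrite patchE ifF//.
  apply/negbTE/negP; rewrite inE => -[_] /= yp.
  by move: ypi; rewrite notin_setE; apply.
rewrite -[RHS](integral_sin_expR_cos (A y) (B y) (sin (y - mu2)) mu1).
rewrite [RHS]integral_mkcond; apply: eq_integral => x _.
rewrite !patchE.
have -> : ((x, y) \in torus) = (x \in circle).
  apply/idP/idP; rewrite !inE; first by case.
  by move=> xpi; split => //=; move: ypi; rewrite inE.
case: ifP => // _; congr EFin.
by rewrite /ss /weight/= mul0r addr0; ring.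
Qed.

Lemma sgr_integral_sin_sin_weight k :
  - pi <= mu1 < pi -> - pi <= mu2 < pi ->
  Num.sg (fine (\int[lebesgue2]_(z in torus) (ss z * weight k z)%:E)%E)
  = Num.sg k.
Proof.
move=> hmu1 hmu2; have [->|k0] := eqVneq k 0.
  by rewrite integral_sin_sin_weight0.
have i1 := integrable_weight k mss ss_le1.
have i0 := integrable_weight 0 mss ss_le1.
have mt := @measurable_torus R.
set J := (\int[lebesgue2]_(z in torus) _)%E.
have fJ : J \is a fin_num by exact: integrable_fin_num.
(* The integral at [k = 0] is zero, so subtracting it from [J] costs nothing and produces the
   difference of weights. *)
have kJ : (k%:E * J = \int[lebesgue2]_(z in torus)
    (k * ss z * (weight k z - weight 0 z))%:E)%E.
  rewrite -[J]sube0 -integral_sin_sin_weight0 -integralB_EFin//.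
  rewrite -integralZl//; last exact: integrableB.
  by apply: eq_integral => z _; rewrite -EFinB -EFinM; congr EFin; ring.
have wE z : k * ss z * (weight k z - weight 0 z)
    = weight 0 z * (k * ss z * (expR (k * ss z) - 1)).
  have -> : weight k z = weight 0 z * expR (k * ss z).
    by rewrite /weight mul0r addr0 -expRD.
  by ring.
(* The exponential is increasing with value 1 at 0, so [u] and [expR u - 1] have the same sign. *)
have u_ge0 (u : R) : 0 <= u * (expR u - 1).
  have [u0|u0] := leP 0 u.
    by rewrite mulr_ge0// subr_ge0 -expR0 ler_expR.
  by rewrite mulr_le0 ?ltW// subr_lt0 -expR0 ltr_expR.
have u_neq0 (u : R) : u != 0 -> u * (expR u - 1) != 0.
  by move=> u0; rewrite mulf_neq0// subr_eq0 -expR0 (inj_eq (@expR_inj R)).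
have : (0 < k%:E * J)%E.
  rewrite kJ; apply: (@integral_torus_gt0 _ mu1 mu2) => //.
  - apply: measurable_funM; first exact: measurable_funM.
    exact: measurable_funB.
  - by move=> z; rewrite wE mulr_ge0// ltW.
  - move=> z s1 s2; rewrite wE; apply: mulf_neq0; first exact: lt0r_neq0.
    by apply: u_neq0; apply: mulf_neq0 => //; exact: mulf_neq0.
(* The product of [k] and the integral is positive, so their signs multiply to 1; as [k] is nonzero,
   the signs coincide. *)
rewrite -(fineK fJ) -EFinM lte_fin => kJ0.
have := gtr0_sg kJ0; rewrite sgrM.
case: (sgrP k) k0 => // _ _; first by rewrite mul1r.
by rewrite mulN1r => /eqP; rewrite eqr_oppLR => /eqP.
Qed.

(** Serves the normalising constant ([h = 1]) and both second moments ([h] a squared sine). The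
    integral is also finite, so [fine] does not collapse it to [0]. *)
Let fine_integral_weight_gt0 k (h : mR * mR -> R) :
  - pi <= mu1 < pi -> - pi <= mu2 < pi ->
  measurable_fun setT h -> (forall z, 0 <= h z <= 1) ->
  (forall z, sin (z.1 - mu1) != 0 -> sin (z.2 - mu2) != 0 -> h z != 0) ->
  0 < fine (\int[lebesgue2]_(z in torus) (h z * weight k z)%:E)%E.
Proof.
move=> hmu1 hmu2 mh h01 hN0; apply: fine_gt0; apply/andP; split.
  apply: (@integral_torus_gt0 _ mu1 mu2) => //.
  - exact: measurable_funM.
  - by move=> z; apply: mulr_ge0; [case/andP: (h01 z)|exact: ltW].
  - by move=> z s1 s2; apply: mulf_neq0; [exact: hN0|exact: lt0r_neq0].
have h1 z : `|h z| <= 1 by case/andP: (h01 z) => h0 ?; rewrite ger0_norm.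
have := integrable_fin_num (@measurable_torus R) (integrable_weight k mh h1).
by rewrite fin_numElt => /andP[].
Qed.

(** * Expectations under the normalised weight and the sign of the coefficient *)

Section law.
Context {d : measure_display} {T : measurableType d} {P : probability T R}.
Variables (X Y : {RV P >-> R}) (k : R).
Hypothesis hlaw : has_joint_pdf X Y (torus_pdf (weight k)).
Hypotheses (hmu1 : - pi <= mu1 < pi) (hmu2 : - pi <= mu2 < pi).

Let Z : R := fine (\int[lebesgue2]_(z in torus) (weight k z)%:E)%E.

Let Z_gt0 : 0 < Z.
Proof.
rewrite /Z; under eq_integral do rewrite -[weight _ _]mul1r.
apply: (@fine_integral_weight_gt0 k (fun=> 1)) => // z.
by rewrite ler01 lexx.
Qed.

(** The expectation is an integral against the joint law of [(X, Y)]. The density of that law turns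
    it into a Lebesgue integral, whose indicator restricts it to the torus and whose constant [Z^-1]
    factors out. *)
Lemma expectation_torus_pdf (h : mR * mR -> R) :
  measurable_fun setT h -> (forall z, `|h z| <= 1) ->
  fine 'E_P[fun w => h (X w, Y w)]
  = fine (\int[lebesgue2]_(z in torus) (h z * weight k z)%:E)%E / Z.
Proof.
move=> mh h1.
pose XY w : mR * mR := (X w, Y w).
have mXY : measurable_fun setT XY.
  have mX : measurable_fun setT (X : T -> R) by [].
  have mY : measurable_fun setT (Y : T -> R) by [].
  exact: (@measurable_fun_pair _ _ _ _ mR mR).
have XYlaw (E : set (mR * mR)) : measurable E -> pushforward P XY E =
    (\int[lebesgue2]_(z in E) (torus_pdf (weight k) z)%:E)%E := @hlaw E.
have mpdf : measurable_fun setT (torus_pdf (weight k) : mR * mR -> R).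
  apply: measurable_funM; first exact: measurable_indic (@measurable_torus R).
  by apply: measurable_funM; [exact: mweight|exact: measurable_cst].
have pdf0 z : 0 <= torus_pdf (weight k) z.
  by rewrite mulr_ge0// divr_ge0// ltW.
have Ph : P.-integrable setT (EFin \o (fun w => h (X w, Y w))).
  apply: measurable_bounded_integrable => //.
  - by apply: (le_lt_trans (probability_le1 P measurableT)); rewrite ltry.
  - exact: measurableT_comp mh mXY.
  - exists 1; split; first exact: num_real.
    by move=> y y1 w _; exact: le_trans (h1 _) (ltW y1).
have -> : 'E_P[fun w => h (X w, Y w)]%E =
    (\int[pushforward P XY]_z (h z)%:E)%E.
  by rewrite unlock (integral_pushforward mXY)//; exact/measurable_EFinP.
rewrite (integral_density mpdf pdf0 XYlaw mh); last exact: mXY.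
have -> : (\int[lebesgue2]_z (h z * torus_pdf (weight k) z)%:E =
    \int[lebesgue2]_(z in torus) (h z * weight k z)%:E * (Z^-1)%:E)%E.
  rewrite -integralZr//; last exact: integrable_weight.
    rewrite [RHS]integral_mkcond; apply: eq_integral => z _.
    rewrite patchE /torus_pdf indicE; case: ifP => _.
      by rewrite mul1r mulrA.
    by rewrite mul0r mulr0.
  exact: measurable_torus.
rewrite fineM//.
apply: (integrable_fin_num (@measurable_torus R)); exact: integrable_weight.
Qed.

Lemma sgr_rho_JS : Num.sg (rho_JS mu1 mu2 X Y) = Num.sg k.
Proof.
have sqr_sin_ge0_le1 (x : R) : 0 <= sin x ^+ 2 <= 1.
  by rewrite sqr_ge0 -real_normK ?num_real// exprn_ile1// sin_max.
have norm_sqr_sin_le1 (x : R) : `|sin x ^+ 2| <= 1.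
  by case/andP: (sqr_sin_ge0_le1 x) => s0 s1; rewrite ger0_norm.
have msqr1 : measurable_fun setT (fun z : mR * mR => sin (z.1 - mu1) ^+ 2).
  exact: measurable_funX.
have msqr2 : measurable_fun setT (fun z : mR * mR => sin (z.2 - mu2) ^+ 2).
  exact: measurable_funX.
rewrite /rho_JS (@expectation_torus_pdf ss)//.
rewrite (@expectation_torus_pdf (fun z => sin (z.1 - mu1) ^+ 2))//.
rewrite (@expectation_torus_pdf (fun z => sin (z.2 - mu2) ^+ 2))//.
(* Only the integral in the numerator can contribute a sign: [Z] and both second moments under the
   root are positive. *)
rewrite !sgrM !sgrV sgr_integral_sin_sin_weight// (gtr0_sg Z_gt0).
rewrite [Num.sg (Num.sqrt _)]gtr0_sg ?mulr1//.
rewrite sqrtr_gt0 mulr_gt0// divr_gt0//;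
  apply: fine_integral_weight_gt0 => // z s1 s2; exact: expf_neq0.
Qed.

End law.
End von_mises_weight.

(** * Specialisation to the sine and cosine models *)

Theorem corollary2p1 (R : realType) (d : measure_display)
    (T : measurableType d) (P : probability T R)
    (Theta Phi : {RV P >-> R}) (mu1 mu2 kappa1 kappa2 kappa3 : R)
    (hmu1 : - pi <= mu1 < pi) (hmu2 : - pi <= mu2 < pi)
    (hkappa1 : 0 <= kappa1) (hkappa2 : 0 <= kappa2)
    (hlaw :
      has_joint_pdf Theta Phi
        (von_mises_sine_pdf kappa1 kappa2 kappa3 mu1 mu2) \/
      has_joint_pdf Theta Phi
        (von_mises_cosine_pdf kappa1 kappa2 kappa3 mu1 mu2)) :
  Num.sg (rho_JS mu1 mu2 Theta Phi) = Num.sg kappa3.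
Proof.
have mcos c : measurable_fun setT
    (fun y : measurableTypeR R => c * cos (y - mu2)).
  apply: continuous_measurable_fun => x.
  apply: cvgM; first exact: cvg_cst.
  apply: (@continuous_comp _ _ _ (fun y : R => y - mu2) cos).
    by apply: cvgB; [exact: cvg_id|exact: cvg_cst].
  exact: continuous_cos.
have cos_le c y : `|c * cos (y - mu2)| <= `|c|.
  by rewrite normrM ler_piMr// cos_max.
case: hlaw => hlaw.
- apply: (@sgr_rho_JS _ (fun=> kappa1) (fun y => kappa2 * cos (y - mu2))
    `|kappa1| `|kappa2| mu1 mu2 _ _ _ _
    _ _ _ Theta Phi kappa3 hlaw) => //.
  exact: mcos.
- have wE : von_mises_cosine_fun kappa1 kappa2 kappa3 mu1 mu2 =
      weight (fun y => kappa1 + kappa3 * cos (y - mu2))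
        (fun y => kappa2 * cos (y - mu2)) mu1 mu2 kappa3.
  apply/funext => -[x y]; rewrite /weight /von_mises_cosine_fun/=.
  (* The subtraction formula splits the interaction: the cosine product joins the coefficient of
     [cos (x - mu1)], and the sine product is exactly the [kappa3] term of [weight]. *)
  have -> : x - mu1 - y + mu2 = (x - mu1) - (y - mu2) by ring.
  by rewrite (cosB (x - mu1)); congr expR; ring.
  move: hlaw; rewrite /von_mises_cosine_pdf wE => hlaw.
  apply: (sgr_rho_JS (CA := `|kappa1| + `|kappa3|) (CB := `|kappa2|)
    _ _ _ _ hlaw) => //.
  + by apply: measurable_funD; [exact: measurable_cst|exact: mcos].
  + exact: mcos.
  + by move=> y; apply: le_trans (ler_normD _ _) _; rewrite lerD2l.
Qed.
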